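(* Let $\phi$ be an orientation-preserving isometry of a spin, closed, hyperbolic $4$-manifold $M=\Gamma\backslash H^4$, and let $\hat\phi$ be a lift of $\phi$ to a symmetry of a spin structure $\hat\Gamma\backslash\mathrm{SU}(1,1;\mathbb H)$ on $M$. Let $P$ be an isolated fixed point of $\phi$, and let $x=(x_1,\dots,x_5)\in H^4$ with $\Gamma x=P$. Let $\Phi$ be the unique element of $\mathrm{SO}^+(4,1)$ such that $\phi=\Phi_\star$ and $\Phi x=x$, and let $\hat\Phi\in\mathrm{SU}(1,1;\mathbb H)$ be the lift of $\Phi$ such that $\hat\phi=\hat\Phi_\star$. Then $$\nu(\hat\phi,P)=\frac{x_5}{2(\mathrm{Re}(\hat\Phi_{11})-\mathrm{Re}(\hat\Phi_{22}))}.$$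
   Context: $\mathrm{SU}(1,1;\mathbb H)=\{A\in\mathbb H(2):A^*JA=J\}$, $J=\mathrm{diag}(1,-1)$, acts on $B^4=\{q\in\mathbb H:|q|<1\}$ by $\begin{pmatrix}a&b\\c&d\end{pmatrix}\cdot q=(aq+b)(cq+d)^{-1}$. Identify $q_0+q_1\mathbf i+q_2\mathbf j+q_3\mathbf k$ with $(q_0,\dots,q_3)\in\mathbb R^4$, let $H^4=\{x\in\mathbb R^5: x_1^2+\dots+x_4^2-x_5^2=-1,\ x_5>0\}$ and $\zeta:B^4\to H^4$, $\zeta(y)=(2y/(1-|y|^2),(1+|y|^2)/(1-|y|^2))$. The double covering epimorphism $\eta:\mathrm{SU}(1,1;\mathbb H)\to\mathrm{SO}^+(4,1)$ is characterized by $\zeta(A\cdot y)=\eta(A)\zeta(y)$. $\Gamma\subset\mathrm{SO}^+(4,1)$ is discrete and torsion-free with $M$ closed, and $\hat\Gamma\subset\mathrm{SU}(1,1;\mathbb H)$ maps isomorphically onto $\Gamma$. Isometries $f_\star(\Gamma x)=\Gamma fx$ ($f$ normalizing $\Gamma$) and symmetries $\hat f_\star(\hat\Gamma\hat h)=\hat\Gamma\hat f\hat h$ ($\hat f$ normalizing $\hat\Gamma$). $\hat\Phi_{ij}$ denotes the $(i,j)$ entry. $\mathrm{Spin}(4)=\eta^{-1}(\mathrm{Stab}(e_5))=\{\mathrm{diag}(p,q):|p|=|q|=1\}$, with half-spin representations (Atiyah–Bott convention) $\Delta_4^+(\mathrm{diag}(p,q))=\Psi_1(p)$, $\Delta_4^-(\mathrm{diag}(p,q))=\Psi_1(q)$,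 where $\Psi_1(a+b\mathbf j)=\begin{pmatrix}a&b\\-\overline b&\overline a\end{pmatrix}$ for $a,b\in\mathbb C$. If $\hat\phi=\hat f_\star$ and $P=\Gamma ge_5$ with $g\in\mathrm{SO}^+(4,1)$ and $\hat g$ a lift of $g$, there is a unique $s\in\mathrm{Spin}(4)$ with $\hat\Gamma\hat f\hat g=\hat\Gamma\hat gs$, and the local contribution of $P$ to the Atiyah–Singer $G$-spin formula is $\nu(\hat\phi,P)=\dfrac{\mathrm{tr}\,\Delta_4^+(s)-\mathrm{tr}\,\Delta_4^-(s)}{|\det(I-d\phi_P)|}$. *)

(* Defs.v *)
From HB Require Import structures.
From mathcomp Require Import all_boot all_order all_algebra.
From mathcomp Require Import reals complex.
Set Implicit Arguments.
Unset Strict Implicit.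
Unset Printing Implicit Defensive.
Import Order.TTheory GRing.Theory Num.Theory.
Local Open Scope ring_scope.

Section Defs.
Variable R : realType.

Record quat := Quat { q0 : R; q1 : R; q2 : R; q3 : R }.

Definition qzero : quat := Quat 0 0 0 0.
Definition qone  : quat := Quat 1 0 0 0.
Definition qadd (p q : quat) : quat :=
  Quat (q0 p + q0 q) (q1 p + q1 q) (q2 p + q2 q) (q3 p + q3 q).
Definition qmul (p q : quat) : quat :=
  Quat (q0 p * q0 q - q1 p * q1 q - q2 p * q2 q - q3 p * q3 q)
       (q0 p * q1 q + q1 p * q0 q + q2 p * q3 q - q3 p * q2 q)
       (q0 p * q2 q - q1 p * q3 q + q2 p * q0 q + q3 p * q1 q)
       (q0 p * q3 q + q1 p * q2 q - q2 p * q1 q + q3 p * q0 q).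
Definition qconj (p : quat) : quat := Quat (q0 p) (- q1 p) (- q2 p) (- q3 p).
Definition qnorm2 (p : quat) : R := q0 p ^+ 2 + q1 p ^+ 2 + q2 p ^+ 2 + q3 p ^+ 2.
Definition qscale (r : R) (p : quat) : quat := Quat (r * q0 p) (r * q1 p) (r * q2 p) (r * q3 p).
Definition qinv (p : quat) : quat := qscale (qnorm2 p)^-1 (qconj p).
Definition qRe (p : quat) : R := q0 p.

Record qmat := QMat { m11 : quat; m12 : quat; m21 : quat; m22 : quat }.

Definition qmat_one : qmat := QMat qone qzero qzero qone.
Definition qmat_mul (A B : qmat) : qmat :=
  QMat (qadd (qmul (m11 A) (m11 B)) (qmul (m12 A) (m21 B)))
       (qadd (qmul (m11 A) (m12 B)) (qmul (m12 A) (m22 B)))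
       (qadd (qmul (m21 A) (m11 B)) (qmul (m22 A) (m21 B)))
       (qadd (qmul (m21 A) (m12 B)) (qmul (m22 A) (m22 B))).
Definition qmat_adj (A : qmat) : qmat :=
  QMat (qconj (m11 A)) (qconj (m21 A)) (qconj (m12 A)) (qconj (m22 A)).
Definition Jq : qmat := QMat qone qzero qzero (Quat (-1) 0 0 0).

Definition inSU11 (A : qmat) : Prop := qmat_mul (qmat_adj A) (qmat_mul Jq A) = Jq.

Definition mob (A : qmat) (q : quat) : quat :=
  qmul (qadd (qmul (m11 A) q) (m12 A)) (qinv (qadd (qmul (m21 A) q) (m22 A))).

Definition inB4 (q : quat) : Prop := qnorm2 q < 1.

(* coordinates x_1..x_5 are the entries 0..4 of a column vector        *)
Definition i5 : 'I_5 := @Ordinal 5 4 isT.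

Definition Qform : 'M[R]_5 := \matrix_(i, j) (if i == j then (if i == i5 then -1 else 1) else 0).

Definition inH4 (x : 'cV[R]_5) : Prop :=
  \sum_(i < 5 | i != i5) x i 0 ^+ 2 - x i5 0 ^+ 2 = -1 /\ 0 < x i5 0.

Definition inSOp41 (L : 'M[R]_5) : Prop :=
  L^T *m Qform *m L = Qform /\ \det L = 1 /\ 0 < L i5 i5.

Definition e5 : 'cV[R]_5 := \col_i (if i == i5 then 1 else 0).

Definition qcoord (q : quat) (i : 'I_5) : R :=
  match val i with 0 => q0 q | 1 => q1 q | 2 => q2 q | _ => q3 q end.

Definition zeta (y : quat) : 'cV[R]_5 :=
  \col_i (if i == i5 then (1 + qnorm2 y) / (1 - qnorm2 y)
          else 2 * qcoord y i / (1 - qnorm2 y)).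

Definition eta_rel (A : qmat) (L : 'M[R]_5) : Prop :=
  forall y, inB4 y -> zeta (mob A y) = L *m zeta y.

Definition is_subgroup_SO (G : 'M[R]_5 -> Prop) : Prop :=
  (forall g, G g -> inSOp41 g) /\ G 1%:M /\
  (forall g h, G g -> G h -> G (g *m h)) /\
  (forall g, G g -> exists h, G h /\ g *m h = 1%:M).

Definition discrete_SO (G : 'M[R]_5 -> Prop) : Prop :=
  exists eps : R, 0 < eps /\
    forall g, G g -> (forall i j, `|g i j - (1%:M : 'M[R]_5) i j| < eps) -> g = 1%:M.

Definition torsion_free_SO (G : 'M[R]_5 -> Prop) : Prop :=
  forall g, G g -> forall n : nat, (0 < n)%N -> g ^+ n = 1%:M -> g = 1%:M.

Definition cocompact_SO (G : 'M[R]_5 -> Prop) : Prop :=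
  exists C : R, forall x, inH4 x -> exists g, G g /\ forall i, `|(g *m x) i 0| <= C.

Definition is_subgroup_SU (G : qmat -> Prop) : Prop :=
  (forall g, G g -> inSU11 g) /\ G qmat_one /\
  (forall g h, G g -> G h -> G (qmat_mul g h)) /\
  (forall g, G g -> exists h, G h /\ qmat_mul g h = qmat_one).

Definition lifts_iso (Gh : qmat -> Prop) (G : 'M[R]_5 -> Prop) : Prop :=
  (forall gh, Gh gh -> exists g, G g /\ eta_rel gh g) /\
  (forall g, G g -> exists gh, Gh gh /\ eta_rel gh g) /\
  (forall gh1 gh2 g, Gh gh1 -> Gh gh2 -> eta_rel gh1 g -> eta_rel gh2 g -> gh1 = gh2).

Definition normalizes_SO (G : 'M[R]_5 -> Prop) (f : 'M[R]_5) : Prop :=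
  (forall g, G g -> exists g', G g' /\ f *m g = g' *m f) /\
  (forall g, G g -> exists g', G g' /\ g *m f = f *m g').

Definition normalizes_SU (G : qmat -> Prop) (f : qmat) : Prop :=
  (forall g, G g -> exists g', G g' /\ qmat_mul f g = qmat_mul g' f) /\
  (forall g, G g -> exists g', G g' /\ qmat_mul g f = qmat_mul f g').

(* points of M : orbits  G x ;  points of Ghat \ SU(1,1;H) : cosets Ghat h *)
Definition Gorbit (G : 'M[R]_5 -> Prop) (x : 'cV[R]_5) : 'cV[R]_5 -> Prop :=
  fun y => exists g, G g /\ y = g *m x.
Definition Gcoset (G : qmat -> Prop) (h : qmat) : qmat -> Prop :=
  fun k => exists g, G g /\ k = qmat_mul g h.
Definition same_set (T : Type) (A B : T -> Prop) : Prop := forall t, A t <-> B t.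

Definition same_isom (G : 'M[R]_5 -> Prop) (f f' : 'M[R]_5) : Prop :=
  forall x, inH4 x -> same_set (Gorbit G (f *m x)) (Gorbit G (f' *m x)).
Definition same_symm (Gh : qmat -> Prop) (fh fh' : qmat) : Prop :=
  forall h, inSU11 h -> same_set (Gcoset Gh (qmat_mul fh h)) (Gcoset Gh (qmat_mul fh' h)).

(* fh_star is a lift of f_star: it covers f_star under the projection
   Ghat h |-> G eta(h) e5 *)
Definition is_lift_symm (G : 'M[R]_5 -> Prop) (fh : qmat) (f : 'M[R]_5) : Prop :=
  forall h Lh Lfh, inSU11 h -> eta_rel h Lh -> eta_rel (qmat_mul fh h) Lfh ->
    same_set (Gorbit G (Lfh *m e5)) (Gorbit G (f *m (Lh *m e5))).

Definition isolated_fixed_point (G : 'M[R]_5 -> Prop) (f : 'M[R]_5) (x : 'cV[R]_5) : Prop :=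
  same_set (Gorbit G (f *m x)) (Gorbit G x) /\
  exists eps : R, 0 < eps /\
    forall y, inH4 y -> (forall i, `|y i 0 - x i 0| < eps) ->
      same_set (Gorbit G (f *m y)) (Gorbit G y) -> same_set (Gorbit G y) (Gorbit G x).

Definition inSpin4 (s : qmat) : Prop :=
  m12 s = qzero /\ m21 s = qzero /\ qnorm2 (m11 s) = 1 /\ qnorm2 (m22 s) = 1.

(* Psi_1 (a + b j) with a = q0 + q1 i, b = q2 + q3 i *)
Definition Psi1 (p : quat) : 'M[R[i]]_2 :=
  let a : R[i] := Complex (q0 p) (q1 p) in
  let b : R[i] := Complex (q2 p) (q3 p) in
  \matrix_(k, l)
    (if k == 0 :> nat then (if l == 0 :> nat then a else b)
     else (if l == 0 :> nat then - conjc b else conjc a)).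

Definition Delta4p (s : qmat) : 'M[R[i]]_2 := Psi1 (m11 s).
Definition Delta4m (s : qmat) : 'M[R[i]]_2 := Psi1 (m22 s).

(* The linear part at e5 of an element L of Stab(e5): its upper-left 4x4 block,
   i.e. the differential on T_{e5} H^4 = span(e1..e4). *)
Definition lin_part (L : 'M[R]_5) : 'M[R]_4 :=
  \matrix_(i, j) L (widen_ord (leqnSn 4) i) (widen_ord (leqnSn 4) j).

(* The local contribution nu(fh_star, P) equals v.  For P = G g e5, a lift gh of g,
   and s in Spin(4) with Ghat fh gh = Ghat gh s, dphi_P is conjugate (via the
   orthonormal frame g e1..g e4 of T_x H^4) to lin_part (eta s).
   We require that such data exist and that every such choice gives v. *)
Definition nu_data (G : 'M[R]_5 -> Prop) (Gh : qmat -> Prop) (fh : qmat)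
    (P : 'cV[R]_5 -> Prop) (g : 'M[R]_5) (gh s : qmat) (Ls : 'M[R]_5) : Prop :=
  inSOp41 g /\ same_set P (Gorbit G (g *m e5)) /\ inSU11 gh /\ eta_rel gh g /\
  inSpin4 s /\ same_set (Gcoset Gh (qmat_mul fh gh)) (Gcoset Gh (qmat_mul gh s)) /\
  eta_rel s Ls.

Definition nu_formula (s : qmat) (Ls : 'M[R]_5) : R[i] :=
  (\tr (Delta4p s) - \tr (Delta4m s)) /
  (`| \det (1%:M - lin_part Ls) |)%:C%C.

Definition is_nu (G : 'M[R]_5 -> Prop) (Gh : qmat -> Prop) (fh : qmat)
    (P : 'cV[R]_5 -> Prop) (v : R[i]) : Prop :=
  (exists g gh s Ls, nu_data G Gh fh P g gh s Ls) /\
  (forall g gh s Ls, nu_data G Gh fh P g gh s Ls -> nu_formula s Ls = v).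

End Defs.

(* Main.v *)
(* A boost k carries the origin of B^4 to the point over x, so the lift of the
   isometry fixing x is k s k^-1 with s = diag(p, q) in Spin(4).  On the
   tangent space s acts by y |-> p y q^-1, and
   det (1 - L_p R_(q^-1)) = 4 (Re p - Re q)^2, so the local contribution is
   1 / (2 (Re p - Re q)).  Comparing diagonal entries of k s k^-1 multiplies
   Re p - Re q by |k_22|^2 + |k_12|^2 = x_5. *)
Require Import Defs.
From HB Require Import structures.
From mathcomp Require Import all_boot all_order all_algebra.
From mathcomp Require Import reals complex ring lra.
Set Implicit Arguments.
Unset Strict Implicit.
Unset Printing Implicit Defensive.
Import Order.TTheory GRing.Theory Num.Theory.
Local Open Scope ring_scope.

(** * Quaternions and SU(1,1;H) *)

Section Quaternions.
Variable R : realType.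
Implicit Types p q r : quat R.

(** The local contribution is quantified over all frames [gh] above the whole orbit of [x], so the
    relation [Phih k = k s] over [x] itself is not given for them. It has to be recovered from a
    frame over another point of the orbit, and this works because [G] acts freely, which must itself
    be extracted from discreteness and the absence of torsion. Matrices in SO^+(4,1) forget a sign:
    [s] and [-s] have the same image but opposite contributions. Hence the comparison must end among
    quaternionic matrices, through the injectivity of the map from [Gh] to [G]. The covering map is
    present only as the relation [eta_rel], tested on the ball, so its multiplicativity and the
    uniqueness of the matrix are derived from the action. *)

Lemma quat_eq p q :
  q0 p = q0 q -> q1 p = q1 q -> q2 p = q2 q -> q3 p = q3 q -> p = q.
Proof. by case: p => ????; case: q => ???? /= -> -> -> ->. Qed.

Lemma qaddACA p q r s : qadd (qadd p q) (qadd r s) = qadd (qadd p r) (qadd q s).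
Proof. by apply: quat_eq => /=; ring. Qed.

Lemma qadd0 p : qadd p (qzero R) = p.
Proof. by apply: quat_eq => /=; ring. Qed.

Lemma q0add p : qadd (qzero R) p = p.
Proof. by apply: quat_eq => /=; ring. Qed.

Lemma qmulA p q r : qmul p (qmul q r) = qmul (qmul p q) r.
Proof. by apply: quat_eq => /=; ring. Qed.

Lemma qmulDl p q r : qmul (qadd p q) r = qadd (qmul p r) (qmul q r).
Proof. by apply: quat_eq => /=; ring. Qed.

Lemma qmulDr p q r : qmul p (qadd q r) = qadd (qmul p q) (qmul p r).
Proof. by apply: quat_eq => /=; ring. Qed.

Lemma qmul1 p : qmul p (qone R) = p.
Proof. by apply: quat_eq => /=; ring. Qed.

Lemma q1mul p : qmul (qone R) p = p.
Proof. by apply: quat_eq => /=; ring. Qed.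

Lemma qmul0 p : qmul p (qzero R) = qzero R.
Proof. by apply: quat_eq => /=; ring. Qed.

Lemma q0mul p : qmul (qzero R) p = qzero R.
Proof. by apply: quat_eq => /=; ring. Qed.

Lemma qconjM p q : qconj (qmul p q) = qmul (qconj q) (qconj p).
Proof. by apply: quat_eq => /=; ring. Qed.

Lemma qconjD p q : qconj (qadd p q) = qadd (qconj p) (qconj q).
Proof. by apply: quat_eq => /=; ring. Qed.

Lemma qnorm2M p q : qnorm2 (qmul p q) = qnorm2 p * qnorm2 q.
Proof. by rewrite /qnorm2 /=; ring. Qed.

Lemma qnorm2_conj p : qnorm2 (qconj p) = qnorm2 p.
Proof. by rewrite /qnorm2 /=; ring. Qed.

Lemma qnorm2_scale (a : R) p : qnorm2 (qscale a p) = a ^+ 2 * qnorm2 p.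
Proof. by rewrite /qnorm2 /=; ring. Qed.

Lemma qnorm2_ge0 p : 0 <= qnorm2 p.
Proof. by rewrite /qnorm2 !addr_ge0 ?sqr_ge0. Qed.

Lemma qnorm2_eq0 p : qnorm2 p = 0 -> p = qzero R.
Proof.
move=> /eqP; rewrite /qnorm2 !paddr_eq0 ?addr_ge0 ?sqr_ge0 // !sqrf_eq0.
by move=> /andP[/andP[/andP[/eqP ? /eqP ?] /eqP ?] /eqP ?]; apply: quat_eq.
Qed.

Lemma qmulV q : qnorm2 q != 0 -> qmul q (qinv q) = qone R.
Proof. by rewrite /qnorm2 => nz; apply: quat_eq; rewrite /qinv /qnorm2 /=; field. Qed.

Lemma qVmul q : qnorm2 q != 0 -> qmul (qinv q) q = qone R.
Proof. by rewrite /qnorm2 => nz; apply: quat_eq; rewrite /qinv /qnorm2 /=; field. Qed.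

Lemma qinvM p q : qinv (qmul p q) = qmul (qinv q) (qinv p).
Proof.
rewrite /qinv qnorm2M invfM qconjM.
by apply: quat_eq => /=; ring.
Qed.

Lemma qinvK q : qinv (qinv q) = q.
Proof.
have [z|nz] := eqVneq (qnorm2 q) 0.
  by rewrite (qnorm2_eq0 z); apply: quat_eq; rewrite /qinv /=; ring.
by move: nz; rewrite /qnorm2=> nz; apply: quat_eq; rewrite /qinv /qnorm2 /=; field.
Qed.

End Quaternions.

Section QuatMatrices.
Variable R : realType.
Implicit Types A B C : qmat R.

Lemma qmat_eq A B : m11 A = m11 B -> m12 A = m12 B -> m21 A = m21 B ->
  m22 A = m22 B -> A = B.
Proof. by case: A => ????; case: B => ???? /= -> -> -> ->. Qed.

Lemma qmat_mulA A B C : qmat_mul A (qmat_mul B C) = qmat_mul (qmat_mul A B) C.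
Proof.
by apply: qmat_eq => /=; rewrite !qmulDl !qmulDr !qmulA qaddACA.
Qed.

Lemma qmat_1mul A : qmat_mul (qmat_one R) A = A.
Proof. by apply: qmat_eq; rewrite /= ?q1mul ?q0mul ?qadd0 ?q0add. Qed.

Lemma qmat_mul1 A : qmat_mul A (qmat_one R) = A.
Proof. by apply: qmat_eq; rewrite /= ?qmul1 ?qmul0 ?qadd0 ?q0add. Qed.

Lemma qmat_adjM A B : qmat_adj (qmat_mul A B) = qmat_mul (qmat_adj B) (qmat_adj A).
Proof. by apply: qmat_eq => /=; rewrite !qconjD !qconjM. Qed.

Lemma Jq_sqr : qmat_mul (Jq R) (Jq R) = qmat_one R.
Proof. by apply: qmat_eq; apply: quat_eq => /=; ring. Qed.

Definition su_inv A : qmat R := qmat_mul (Jq R) (qmat_mul (qmat_adj A) (Jq R)).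

Lemma su_mulVl A : inSU11 A -> qmat_mul (su_inv A) A = qmat_one R.
Proof. by move=> hA; rewrite /su_inv -!qmat_mulA hA Jq_sqr. Qed.

Lemma inSU11_mul A B : inSU11 A -> inSU11 B -> inSU11 (qmat_mul A B).
Proof.
rewrite /inSU11 => hA hB.
by rewrite qmat_adjM -qmat_mulA (qmat_mulA (Jq R)) (qmat_mulA (qmat_adj A)) hA.
Qed.

(** The two off-diagonal entries of the defining equation are conjugate, so one of them suffices. *)
Lemma inSU11E A : inSU11 A <->
  [/\ qnorm2 (m11 A) = 1 + qnorm2 (m21 A), qnorm2 (m22 A) = 1 + qnorm2 (m12 A) &
      qmul (qconj (m11 A)) (m12 A) = qmul (qconj (m21 A)) (m22 A)].
Proof.
case: A => a b c d; rewrite /inSU11 /qnorm2 /=; split.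
  move=> e.
  have e11 := congr1 (fun M => q0 (m11 M)) e; have e22 := congr1 (fun M => q0 (m22 M)) e.
  have e12_0 := congr1 (fun M => q0 (m12 M)) e; have e12_1 := congr1 (fun M => q1 (m12 M)) e.
  have e12_2 := congr1 (fun M => q2 (m12 M)) e; have e12_3 := congr1 (fun M => q3 (m12 M)) e.
  move: e11 e22 e12_0 e12_1 e12_2 e12_3 => /= *; split; [lra|lra|].
  by apply: quat_eq => /=; lra.
case=> e1 e2 e3.
have e30 := congr1 (@q0 R) e3; have e31 := congr1 (@q1 R) e3.
have e32 := congr1 (@q2 R) e3; have e33 := congr1 (@q3 R) e3.
move: e30 e31 e32 e33 => /= *.
by apply: qmat_eq; apply: quat_eq => /=; lra.
Qed.

(** Norms in the off-diagonal relation give (1 + |c|^2)|b|^2 = |c|^2(1 + |b|^2), and the mixed terms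
    cancel. *)
Lemma su_norms A : inSU11 A ->
  qnorm2 (m21 A) = qnorm2 (m12 A) /\ qnorm2 (m11 A) = qnorm2 (m22 A).
Proof.
move=> /inSU11E[e1 e2 /(congr1 (@qnorm2 R))].
rewrite !qnorm2M !qnorm2_conj e1 e2 => h.
have e : qnorm2 (m21 A) = qnorm2 (m12 A) by lra.
by rewrite e.
Qed.

(** The off-diagonal relation for the adjoint of [A], needed to make [su_inv] a right inverse.
    Scaling by the nonzero real |a|^2 = |d|^2 creates the factor conj(c) d, which may be replaced by
    conj(a) b without commuting anything. *)
Lemma su_offdiag A : inSU11 A ->
  qmul (m11 A) (qconj (m21 A)) = qmul (m12 A) (qconj (m22 A)).
Proof.
move=> hA; have [n1 n2] := su_norms hA; have [e1 _ e] := (inSU11E A).1 hA.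
have nz : qnorm2 (m11 A) != 0 by rewrite e1 lt0r_neq0 // ltr_pwDl // qnorm2_ge0.
have : qscale (qnorm2 (m11 A)) (qmul (m11 A) (qconj (m21 A))) =
       qscale (qnorm2 (m11 A)) (qmul (m12 A) (qconj (m22 A))).
  rewrite {1}n2.
  have -> : qscale (qnorm2 (m22 A)) (qmul (m11 A) (qconj (m21 A))) =
    qmul (m11 A) (qmul (qmul (qconj (m21 A)) (m22 A)) (qconj (m22 A))).
    by apply: quat_eq; rewrite /qnorm2 /=; ring.
  by rewrite -e; apply: quat_eq; rewrite /qnorm2 /=; ring.
move: nz; move: (qnorm2 _) => n nz; case: (qmul _ _) => ????; case: (qmul _ _) => ????.
by case=> /(mulfI nz)-> /(mulfI nz)-> /(mulfI nz)-> /(mulfI nz)->.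
Qed.

Lemma su_mulVr A : inSU11 A -> qmat_mul A (su_inv A) = qmat_one R.
Proof.
move=> hA; have [n1 n2] := su_norms hA; have [e1 e2 _] := (inSU11E A).1 hA.
have e := su_offdiag hA.
have e30 := congr1 (@q0 R) e; have e31 := congr1 (@q1 R) e.
have e32 := congr1 (@q2 R) e; have e33 := congr1 (@q3 R) e.
case: A {hA e} n1 n2 e1 e2 e30 e31 e32 e33 => a b c d; rewrite /qnorm2 /= => *.
by apply: qmat_eq; apply: quat_eq => /=; lra.
Qed.

Lemma inSU11_inv A : inSU11 A -> inSU11 (su_inv A).
Proof.
move=> hA; rewrite /inSU11.
have adjinv : qmat_adj (su_inv A) = qmat_mul (Jq R) (qmat_mul A (Jq R)).
  by apply: qmat_eq; apply: quat_eq => /=; ring.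
rewrite adjinv -!qmat_mulA [qmat_mul (Jq R) (qmat_mul (Jq R) _)]qmat_mulA Jq_sqr.
by rewrite qmat_1mul su_mulVr // qmat_mul1.
Qed.

End QuatMatrices.

(** * The action on the ball and the hyperboloid *)

Local Notation o0 := (@Ordinal 5 0 isT).
Local Notation o1 := (@Ordinal 5 1 isT).
Local Notation o2 := (@Ordinal 5 2 isT).
Local Notation o3 := (@Ordinal 5 3 isT).

Lemma ord5P (P : 'I_5 -> Prop) :
  P o0 -> P o1 -> P o2 -> P o3 -> P i5 -> forall i, P i.
Proof.
move=> ? ? ? ? ? [[|[|[|[|[|i]]]]] h] //.
all: by rewrite (bool_irrelevance h isT).
Qed.

Lemma sum5E (V : nmodType) (F : 'I_5 -> V) :
  \sum_i F i = F o0 + F o1 + F o2 + F o3 + F i5.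
Proof.
rewrite !big_ord_recl big_ord0 addr0 !addrA.
by do ![congr (_ + _)]; congr F; apply: val_inj.
Qed.

Section Moebius.
Variable R : realType.
Implicit Types (A B : qmat R) (K L : 'M[R]_5) (y : quat R).

Definition mnum A y := qadd (qmul (m11 A) y) (m12 A).
Definition mden A y := qadd (qmul (m21 A) y) (m22 A).

Lemma qnorm2_affine (a b y : quat R) : qnorm2 (qadd (qmul a y) b) =
  qnorm2 a * qnorm2 y + qnorm2 b + 2 * qRe (qmul (qconj y) (qmul (qconj a) b)).
Proof. by rewrite /qRe /qnorm2 /=; ring. Qed.

(** Invariance of the form [Jq] on the vector (y, 1). It yields both the nonvanishing of
    denominators and the invariance of the ball. *)
Lemma mden_mnum A y : inSU11 A ->
  qnorm2 (mden A y) - qnorm2 (mnum A y) = 1 - qnorm2 y.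
Proof.
move=> /inSU11E[e1 e2 e]; rewrite !qnorm2_affine e e1 e2; ring.
Qed.

Lemma mden_gt0 A y : inSU11 A -> inB4 y -> 0 < qnorm2 (mden A y).
Proof.
move=> /(mden_mnum y) + hy; move: hy; rewrite /inB4.
have := qnorm2_ge0 (mnum A y); lra.
Qed.

Lemma mobE A y : mob A y = qmul (mnum A y) (qinv (mden A y)).
Proof. by []. Qed.

Lemma qnorm2_div (p q : quat R) :
  qnorm2 q != 0 -> qnorm2 (qmul p (qinv q)) = qnorm2 p / qnorm2 q.
Proof. by move=> nz; rewrite qnorm2M /qinv qnorm2_scale qnorm2_conj; field. Qed.

Lemma mob_inB4 A y : inSU11 A -> inB4 y -> inB4 (mob A y).
Proof.
move=> hA hy; have d0 := mden_gt0 hA hy.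
rewrite /inB4 mobE qnorm2_div ?gt_eqF // ltr_pdivrMr // mul1r.
by have := mden_mnum y hA; move: hy; rewrite /inB4; lra.
Qed.

Lemma mob_mul A B y : inSU11 A -> inSU11 B -> inB4 y ->
  mob (qmat_mul A B) y = mob A (mob B y).
Proof.
move=> hA hB hy; have d0 := mden_gt0 hB hy.
have nz : qnorm2 (mden B y) != 0 by rewrite gt_eqF.
rewrite 2!mobE.
(* Numerator and denominator acquire the same right factor, which cancels in the quotient. *)
have eD p q : qadd (qmul p (mob B y)) q =
    qmul (qadd (qmul p (mnum B y)) (qmul q (mden B y))) (qinv (mden B y)).
  by rewrite qmulDl -!qmulA qmulV // qmul1.
have eN : mnum (qmat_mul A B) y =
    qadd (qmul (m11 A) (mnum B y)) (qmul (m12 A) (mden B y)).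
  by apply: quat_eq => /=; ring.
have eM : mden (qmat_mul A B) y =
    qadd (qmul (m21 A) (mnum B y)) (qmul (m22 A) (mden B y)).
  by apply: quat_eq => /=; ring.
rewrite eN eM /(mnum A) /(mden A) !eD qinvM qinvK.
by rewrite -qmulA (qmulA (qinv (mden B y))) qVmul // q1mul.
Qed.

Lemma mob_one y : mob (qmat_one R) y = y.
Proof.
rewrite mobE /mnum /mden /= !q1mul !q0mul qadd0 q0add.
have -> : qinv (qone R) = qone R.
  by apply: quat_eq; rewrite /qinv /qnorm2 /= !expr0n /= expr1n !addr0 invr1 !mul1r ?oppr0.
by rewrite qmul1.
Qed.

(** The denominator 1 - |A y|^2 equals (1 - |y|^2) / |[mden A y]|^2, so the denominators of the
    action disappear and only that of [zeta y] remains. *)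
Lemma zeta_mob A y : inSU11 A -> inB4 y -> zeta (mob A y) =
  \col_i (if i == i5 then (qnorm2 (mden A y) + qnorm2 (mnum A y)) / (1 - qnorm2 y)
          else 2 * qcoord (qmul (mnum A y) (qconj (mden A y))) i / (1 - qnorm2 y)).
Proof.
move=> hA hy; have d0 := mden_gt0 hA hy; have e := mden_mnum y hA.
have n0 : qnorm2 (mden A y) != 0 by rewrite gt_eqF.
have n1 : 1 - qnorm2 y != 0 by rewrite gt_eqF // subr_gt0.
rewrite mobE; apply/colP => i; rewrite !mxE qnorm2_div // -e.
rewrite -e in n1.
have hc (p q : quat R) : qcoord (qmul p (qinv q)) i = qcoord (qmul p (qconj q)) i / qnorm2 q.
  rewrite /qinv; move: (qnorm2 q) => n.
  by rewrite /qcoord; case: (val i) => [|[|[|?]]] /=; ring.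
by rewrite hc; case: ifP => _; field; rewrite ?n0 ?n1.
Qed.

Lemma zeta0 : zeta (qzero R) = e5 R.
Proof.
apply/colP => i; rewrite !mxE /qnorm2 /= expr0n /= !addr0 subr0 divr1.
by case: ifP => // _; rewrite /qcoord; case: (val i) => [|[|[|?]]] /=; rewrite mulr0 mul0r.
Qed.

Lemma inB4_0 : inB4 (qzero R).
Proof. by rewrite /inB4 /qnorm2 /= expr0n /= !addr0 ltr01. Qed.

Lemma eta_mul A B K L : inSU11 A -> inSU11 B -> eta_rel A K -> eta_rel B L ->
  eta_rel (qmat_mul A B) (K *m L).
Proof.
move=> hA hB eA eB y hy.
by rewrite mob_mul // eA ?eB ?mulmxA //; apply: mob_inB4.
Qed.

Definition qbasis (i : 'I_5) : quat R :=
  Quat (i == o0)%:R (i == o1)%:R (i == o2)%:R (i == o3)%:R.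

Lemma qnorm2_basis i : i != i5 -> qnorm2 (qbasis i) = 1.
Proof.
by move: i; apply: ord5P => //= _; rewrite /qnorm2 /=; ring.
Qed.

(** Unit quaternions lie on the boundary of the ball, hence the factor 1/2. Together with the origin
    these test points have [zeta]-images spanning R^5. *)
Definition qhalf i := qscale (1 / 2) (qbasis i).

Lemma qnorm2_half i : i != i5 -> qnorm2 (qhalf i) = 1 / 4.
Proof. by move=> h; rewrite qnorm2_scale qnorm2_basis //; field. Qed.

Lemma qhalf_inB4 i : i != i5 -> inB4 (qhalf i).
Proof. by move=> h; rewrite /inB4 qnorm2_half //; lra. Qed.

Lemma zeta_half i : i != i5 ->
  zeta (qhalf i) = (4 / 3) *: delta_mx i 0 + (5 / 3) *: e5 R.
Proof.
move=> h; apply/colP => j; rewrite !mxE qnorm2_half // eqxx andbT.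
case: eqP => [->|].
  by rewrite eq_sym (negPf h) /=; field.
by move: i j h; apply: ord5P => //=; apply: ord5P => //= _ _; rewrite /qcoord /=; field.
Qed.

Lemma mx_col_ext K L : K *m e5 R = L *m e5 R ->
  (forall i, i != i5 -> K *m delta_mx i 0 = L *m delta_mx i 0 :> 'cV_5) -> K = L.
Proof.
move=> h5 h; apply/matrixP => i j.
have eN (N : 'M[R]_5) : N i j = (N *m (delta_mx j 0 : 'cV_5)) i 0.
  by rewrite -colE mxE.
rewrite 2!eN.
have [->|/h->//] := eqVneq j i5.
have -> : delta_mx i5 0 = e5 R by apply/colP => k; rewrite !mxE andbT; case: eqP.
by rewrite h5.
Qed.

(** Used to turn an identity between quaternionic matrices into one between their images. *)
Lemma eta_unique A K L : eta_rel A K -> eta_rel A L -> K = L.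
Proof.
move=> eK eL.
have h y : inB4 y -> K *m zeta y = L *m zeta y by move=> hy; rewrite -eK // eL.
have h5 : K *m e5 R = L *m e5 R by rewrite -zeta0 h //; apply: inB4_0.
apply: mx_col_ext => // i hi; have := h _ (qhalf_inB4 hi).
rewrite zeta_half // !mulmxDr -!scalemxAr h5 => /addIr /scalerI -> //.
by rewrite gt_eqF // divr_gt0.
Qed.

End Moebius.

(** * Boosts *)

Section Boosts.
Variable R : realType.
Implicit Types (y v : quat R).

(** The Lorentz boost along the geodesic from [e5] to [zeta v]; the coefficient of v v^T in the
    spatial block is (cosh rho - 1)/|v|^2 = 2/(1 - |v|^2), where |v| = tanh(rho/2). *)
Definition boost_mx v : 'M[R]_5 := \matrix_(i, j)
  (if i == i5 then
     if j == i5 then (1 + qnorm2 v) / (1 - qnorm2 v)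
     else 2 * qcoord v j / (1 - qnorm2 v)
   else if j == i5 then 2 * qcoord v i / (1 - qnorm2 v)
   else (i == j)%:R + 2 * qcoord v i * qcoord v j / (1 - qnorm2 v)).

(** The transvection z -> (z + v)(conj(v) z + 1)^-1, normalized to preserve [Jq]. *)
Definition boost_qmat v : qmat R :=
  let r := (Num.sqrt (1 - qnorm2 v))^-1 in
  QMat (qscale r (qone R)) (qscale r v) (qscale r (qconj v)) (qscale r (qone R)).

Lemma boost_mx_e5 v : boost_mx v *m e5 R = zeta v.
Proof.
have -> : e5 R = delta_mx i5 0 by apply/colP => k; rewrite !mxE andbT; case: eqP.
by rewrite -colE; apply/colP => i; rewrite !mxE eqxx.
Qed.

Lemma boost_mx_form v : inB4 v -> (boost_mx v)^T *m Qform R *m boost_mx v = Qform R.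
Proof.
rewrite /inB4 -subr_gt0 => /lt0r_neq0; rewrite /qnorm2 => nz.
have eQ : Qform R *m boost_mx v =
    \matrix_(i, j) (if i == i5 then - boost_mx v i j else boost_mx v i j).
  apply/matrixP => i j; rewrite mxE sum5E [in RHS]mxE ![Qform _ _ _]mxE.
  by move: i; apply: ord5P => /=; ring.
rewrite -mulmxA eQ.
apply/matrixP; apply: ord5P; apply: ord5P; rewrite !mxE sum5E !mxE /=;
  rewrite /qcoord /qnorm2 /=; field; exact: nz.
Qed.

(** A boost of rapidity rho has |v| = tanh(rho/2), so the scaling factor is the duplication formula
    of tanh. *)
Lemma boost_mx_double v : inB4 v ->
  boost_mx (qscale (2 / (1 + qnorm2 v)) v) = boost_mx v *m boost_mx v.
Proof.
rewrite /inB4 => lt1.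
have n0 : 1 + qnorm2 v != 0 by rewrite gt_eqF // ltr_pwDl // qnorm2_ge0.
have n1 : 1 - qnorm2 v != 0 by rewrite gt_eqF // subr_gt0.
set w := qscale _ v.
have -> : boost_mx w = \matrix_(i, j)
  (if i == i5 then
     if j == i5 then ((1 + qnorm2 v) ^+ 2 + 4 * qnorm2 v) / (1 - qnorm2 v) ^+ 2
     else 4 * (1 + qnorm2 v) * qcoord v j / (1 - qnorm2 v) ^+ 2
   else if j == i5 then 4 * (1 + qnorm2 v) * qcoord v i / (1 - qnorm2 v) ^+ 2
   else (i == j)%:R + 8 * qcoord v i * qcoord v j / (1 - qnorm2 v) ^+ 2).
  have en : qnorm2 w = 4 * qnorm2 v / (1 + qnorm2 v) ^+ 2.
    by rewrite qnorm2_scale; field.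
  have ew i : qcoord w i = 2 / (1 + qnorm2 v) * qcoord v i.
    by rewrite /w /qcoord; case: (val i) => [|[|[|?]]].
  have dw : 1 - qnorm2 w = (1 - qnorm2 v) ^+ 2 / (1 + qnorm2 v) ^+ 2.
    by rewrite en; field.
  apply/matrixP => i j; rewrite !mxE !ew dw en.
  by case: ifP => _; case: ifP => _; field; rewrite ?n0 ?n1.
move: n1; rewrite /qnorm2 => n1.
apply/matrixP; apply: ord5P; apply: ord5P; rewrite !mxE sum5E !mxE /=;
  rewrite /qcoord /qnorm2 /=; field; exact: n1.
Qed.

Lemma det_form (S : 'M[R]_5) : S^T *m Qform R *m S = Qform R -> (\det S) ^+ 2 = 1.
Proof.
have QQ : Qform R *m Qform R = 1%:M.
  apply/matrixP; apply: ord5P; apply: ord5P; rewrite !mxE sum5E !mxE /=; ring.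
have dQ : \det (Qform R) != 0.
  move: (congr1 determinant QQ); rewrite det_mulmx det1.
  by apply: contra_eq_neq => ->; rewrite mul0r eq_sym oner_neq0.
move=> /(congr1 determinant); rewrite !det_mulmx det_tr => h.
by apply: (mulfI dQ); rewrite mulr1 -{2}h; ring.
Qed.

(* Halving the rapidity exhibits a boost as a square, so its determinant is 1. *)
Lemma boost_half v : inB4 v ->
  exists2 w, inB4 w & v = qscale (2 / (1 + qnorm2 w)) w.
Proof.
rewrite /inB4 => lt1; set s := Num.sqrt (1 - qnorm2 v).
have s0 : 0 < s by rewrite sqrtr_gt0 subr_gt0.
have s2 : qnorm2 v = 1 - s ^+ 2 by rewrite sqr_sqrtr ?subr_ge0 ?ltW //; ring.
have nz : 1 + s != 0 by rewrite gt_eqF // addr_gt0.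
(* For w = t v, the equation 2 w/(1 + |w|^2) = v is quadratic in t; the root with w in the ball is t
   = 1/(1 + s). *)
have en : qnorm2 (qscale (1 + s)^-1 v) = (1 - s) / (1 + s).
  by rewrite qnorm2_scale s2; field.
exists (qscale (1 + s)^-1 v); rewrite en.
  by rewrite ltr_pdivrMr ?addr_gt0 // mul1r; lra.
have e : 2 / (1 + (1 - s) / (1 + s)) = 1 + s.
  by field; rewrite nz /=; apply/eqP; lra.
by rewrite e; apply: quat_eq => /=; rewrite mulrA divff // mul1r.
Qed.

Lemma boost_mx_SO v : inB4 v -> inSOp41 (boost_mx v).
Proof.
move=> hv; split; first exact: boost_mx_form.
split.
  have [w hw ->] := boost_half hv.
  by rewrite boost_mx_double // det_mulmx -expr2 det_form // boost_mx_form.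
by rewrite mxE eqxx divr_gt0 ?subr_gt0 // ltr_pwDl // qnorm2_ge0.
Qed.

Lemma boost_scale_sqr v : inB4 v ->
  (Num.sqrt (1 - qnorm2 v))^-1 ^+ 2 = (1 - qnorm2 v)^-1.
Proof. by rewrite /inB4 => h; rewrite exprVn sqr_sqrtr // subr_ge0 ltW. Qed.

Lemma boost_qmat_SU v : inB4 v -> inSU11 (boost_qmat v).
Proof.
move=> hv; have r2 := boost_scale_sqr hv.
have nz : 1 - qnorm2 v != 0 by rewrite gt_eqF // subr_gt0.
apply/inSU11E; rewrite /boost_qmat; move: r2; set r := _^-1 => r2 /=.
have q1 : qnorm2 (qone R) = 1 by rewrite /qnorm2 /=; ring.
rewrite !qnorm2_scale qnorm2_conj q1 r2; split; [by field|by field|].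
by apply: quat_eq => /=; ring.
Qed.

Lemma boost_eta v : inB4 v -> eta_rel (boost_qmat v) (boost_mx v).
Proof.
move=> hv z hz; rewrite zeta_mob //; last exact: boost_qmat_SU.
have r2 := boost_scale_sqr hv.
have nv : 1 - qnorm2 v != 0 by rewrite gt_eqF // subr_gt0.
have nz : 1 - qnorm2 z != 0 by rewrite gt_eqF // subr_gt0.
set r := (Num.sqrt (1 - qnorm2 v))^-1 in r2.
have -> : mnum (boost_qmat v) z = qscale r (qadd z v).
  by apply: quat_eq => /=; rewrite -/r; ring.
have -> : mden (boost_qmat v) z = qscale r (qadd (qmul (qconj v) z) (qone R)).
  by apply: quat_eq => /=; rewrite -/r; ring.
rewrite !qnorm2_scale r2.
have -> p q : qmul (qscale r p) (qconj (qscale r q)) =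
             qscale ((1 - qnorm2 v)^-1) (qmul p (qconj q)).
  by rewrite -r2; apply: quat_eq => /=; ring.
move: nv nz; rewrite /qnorm2 => nv nz.
apply/colP; apply: ord5P; rewrite !mxE sum5E !mxE /=;
  rewrite /qcoord /qnorm2 /=; field; by rewrite ?nv ?nz.
Qed.

Lemma zeta_surj (x : 'cV[R]_5) : inH4 x -> exists2 y, inB4 y & zeta y = x.
Proof.
rewrite /inH4 big_mkcond /= sum5E /= => -[h t0].
set t := x i5 0 in h t0 *.
have t1 : 1 + t != 0 by rewrite gt_eqF // addr_gt0.
(* Stereographic projection from [- e5 R]. *)
pose y := Quat (x o0 0 / (1 + t)) (x o1 0 / (1 + t)) (x o2 0 / (1 + t)) (x o3 0 / (1 + t)).
have ny : qnorm2 y = (t - 1) / (1 + t).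
  have -> : qnorm2 y = (x o0 0 ^+ 2 + x o1 0 ^+ 2 + x o2 0 ^+ 2 + x o3 0 ^+ 2) / (1 + t) ^+ 2.
    by rewrite /qnorm2 /=; field.
  have -> : x o0 0 ^+ 2 + x o1 0 ^+ 2 + x o2 0 ^+ 2 + x o3 0 ^+ 2 = t ^+ 2 - 1.
    by move: h; rewrite addr0; lra.
  by field.
have d : 1 - qnorm2 y = 2 / (1 + t) by rewrite ny; field.
exists y.
  by rewrite /inB4 -subr_gt0 d divr_gt0 // addr_gt0.
apply/colP; apply: ord5P; rewrite !mxE /= d ?ny /qcoord /= -/t;
  by field; rewrite ?t1.
Qed.

End Boosts.

(** * The fixed-point determinant *)

Section Determinant.
Variable R : realType.

Lemma det_mx22 (M : 'M[R]_2) : let m i j := M (inord i) (inord j) in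
  \det M = m 0 0 * m 1 1 - m 0 1 * m 1 0.
Proof.
move=> m; rewrite (expand_det_row _ ord0) !big_ord_recl big_ord0 /cofactor !det_mx11 !mxE.
have e (i j : 'I_2) : M i j = m i j by rewrite /m !inord_val.
by rewrite !e /= /bump /=; ring.
Qed.

Lemma det_mx33 (M : 'M[R]_3) : let m i j := M (inord i) (inord j) in
  \det M = m 0 0 * (m 1 1 * m 2 2 - m 1 2 * m 2 1)
         - m 0 1 * (m 1 0 * m 2 2 - m 1 2 * m 2 0)
         + m 0 2 * (m 1 0 * m 2 1 - m 1 1 * m 2 0).
Proof.
move=> m; rewrite (expand_det_row _ ord0) !big_ord_recl big_ord0 /cofactor !det_mx22 !mxE.
have e (i j : 'I_3) : M i j = m i j by rewrite /m !inord_val.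
by rewrite !e /= /bump /= !inordK //=; ring.
Qed.

Lemma det_mx44 (M : 'M[R]_4) : let m i j := M (inord i) (inord j) in
  let d3 a b c := m 1 a * (m 2 b * m 3 c - m 2 c * m 3 b)
         - m 1 b * (m 2 a * m 3 c - m 2 c * m 3 a)
         + m 1 c * (m 2 a * m 3 b - m 2 b * m 3 a) in
  \det M = m 0 0 * d3 1 2 3 - m 0 1 * d3 0 2 3 + m 0 2 * d3 0 1 3 - m 0 3 * d3 0 1 2.
Proof.
move=> m d3; rewrite (expand_det_row _ ord0) !big_ord_recl big_ord0 /cofactor !det_mx33 !mxE.
have e (i j : 'I_4) : M i j = m i j by rewrite /m !inord_val.
by rewrite !e /= /bump /= !inordK //= /d3; ring.
Qed.

(** With Re p = cos a and Re q = cos b, the map y -> p y conj(q) rotates two orthogonal planes by a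
    + b and a - b, and (2 - 2 cos(a + b))(2 - 2 cos(a - b)) = 4(cos a - cos b)^2. *)
Lemma det_sub_rotation (p q : quat R) :
  qnorm2 p = 1 -> qnorm2 q = 1 ->
  \det (1%:M - \matrix_(i < 4, j < 4)
    qcoord (qmul (qmul p (qbasis R (widen_ord (leqnSn 4) j))) (qconj q))
      (widen_ord (leqnSn 4) i)) = 4 * (qRe p - qRe q) ^+ 2.
Proof.
(* The new right-hand side is the determinant for arbitrary [p] and [q], which leaves a polynomial
   identity without side conditions. *)
move=> p1 q1; have -> : 4 * (qRe p - qRe q) ^+ 2 =
  (1 + qnorm2 p * qnorm2 q) ^+ 2 - 4 * (1 + qnorm2 p * qnorm2 q) * qRe p * qRe q +
  4 * (qRe p ^+ 2 * qnorm2 q + qRe q ^+ 2 * qnorm2 p - qnorm2 p * qnorm2 q).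
  by rewrite p1 q1; ring.
clear.
have e (k : nat) (h : (k < 4)%N) : inord k = Ordinal h :> 'I_4.
  by apply: val_inj; rewrite /= inordK.
rewrite det_mx44 (e 0 isT) (e 1 isT) (e 2 isT) (e 3 isT) !mxE /qcoord /qRe /qnorm2 /=; ring.
Qed.
End Determinant.

(** * Freeness of the action *)

Section FreeAction.
Variable R : realType.

(** Pigeonhole: [-1, 1] is cut into cells of width 1/N < [eps], and two of the matrices agree in the
    cells of all their entries. *)
Lemma bounded_mx_seq_recurrent n (A : nat -> 'M[R]_n) (eps : R) : 0 < eps ->
  (forall k i j, `|A k i j| <= 1) ->
  exists k m, (0 < m)%N /\ forall i j, `|A (k + m)%N i j - A k i j| < eps.
Proof.
move=> eps0 A1.
pose N := (Num.truncn eps^-1).+1.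
have N0 : 0 < N%:R :> R by rewrite ltr0n.
have Neps : 1 < N%:R * eps.
  by rewrite -ltr_pdivrMr // mul1r /N; apply: truncnS_gt.
(* The endpoint a = 1 has a cell of its own, hence 2N + 1 values; [inord] is never out of range when
   |a| <= 1. *)
pose c (a : R) : 'I_(2 * N).+1 := inord (Num.truncn ((a + 1) * N%:R)).
have cP a b : `|a| <= 1 -> `|b| <= 1 -> c a = c b -> `|b - a| < eps.
  have cE d : `|d| <= 1 -> (c d)%:R <= (d + 1) * N%:R < (c d)%:R + 1.
    move=> /ler_normlP[d1 d2].
    have d0 : 0 <= (d + 1) * N%:R by rewrite mulr_ge0 ?(ltW N0) //; lra.
    have /andP[l u] := truncn_itv d0.
    rewrite inordK; first by rewrite l -natr1 in u *; rewrite u.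
    rewrite ltnS -(ler_nat R) (le_trans l) // natrM ler_wpM2r ?(ltW N0) //; lra.
  move=> /cE ha /cE hb e; rewrite -e in hb.
  have : `|b - a| * N%:R < 1.
    rewrite -[X in _ * X](gtr0_norm N0) -normrM ltr_norml.
    by move: ha hb => /andP[? ?] /andP[? ?]; apply/andP; split; lra.
  by move=> h; rewrite -(ltr_pM2r N0) (lt_trans h) // mulrC.
pose T := {ffun 'I_n * 'I_n -> 'I_(2 * N).+1}.
pose F (k : 'I_#|T|.+1) : T := [ffun ij => c (A k ij.1 ij.2)].
have /injectivePn[k [l kl Fkl]] : ~~ injectiveb F.
  by apply/injectiveP => /leq_card; rewrite card_ord ltnn.
wlog lt_kl : k l kl Fkl / (k < l)%N.
  move=> W; have [lt|lt|/val_inj e] := ltngtP k l.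
  - exact: (W k l).
  - by apply: (W l k); rewrite // eq_sym.
  - by rewrite e eqxx in kl.
exists k, (l - k)%N; rewrite subn_gt0 lt_kl subnKC ?(ltnW lt_kl) //; split=> // i j.
by apply: cP => //; move/ffunP: Fkl => /(_ (i, j)); rewrite !ffunE.
Qed.

Lemma orthogonal_entry_le1 n (A : 'M[R]_n) : A^T *m A = 1%:M ->
  forall i j, `|A i j| <= 1.
Proof.
move=> h i j; have := congr1 (fun M : 'M[R]_n => M j j) h.
rewrite !mxE eqxx /= (bigD1 i) //= mxE => e.
have s0 : 0 <= \sum_(k | k != i) A^T j k * A k j.
  by apply: sumr_ge0 => k _; rewrite mxE -expr2 sqr_ge0.
by rewrite -(@expr_le1 _ 2) // real_normK ?num_real //; lra.
Qed.

Lemma orthogonal_exp n (A : 'M[R]_n.+1) k : A^T *m A = 1%:M ->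
  (A ^+ k)^T *m (A ^+ k) = 1%:M.
Proof.
move=> h; elim: k => [|k IH]; first by rewrite expr0 trmx1 mul1mx.
by rewrite exprSr trmx_mul -mulmxA (mulmxA _ (A ^+ k)) IH mul1mx.
Qed.

Lemma orthogonal_recurrent n (A : 'M[R]_n.+1) (eps : R) : 0 < eps ->
  A^T *m A = 1%:M ->
  exists m, (0 < m)%N /\ forall i j, `|(A ^+ m - 1%:M) i j| < eps.
Proof.
move=> eps0 h.
have e0 : 0 < eps / n.+1%:R by rewrite divr_gt0.
have [k [m [m0 hk]]] := bounded_mx_seq_recurrent e0
  (fun k => orthogonal_entry_le1 (orthogonal_exp k h)).
exists m; split=> // i j.
(* The left factor has entries of absolute value at most 1, so the sum over n + 1 indices costs the
   factor already divided out of [eps]. *)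
have -> : A ^+ m - 1%:M = (A ^+ k)^T *m (A ^+ (k + m) - A ^+ k).
  by rewrite mulmxBr orthogonal_exp // exprD [_ * _]/(_ *m _) mulmxA orthogonal_exp // mul1mx.
rewrite mxE (le_lt_trans (ler_norm_sum _ _ _)) //.
have -> : eps = \sum_(l < n.+1) (eps / n.+1%:R).
  by rewrite sumr_const card_ord -[RHS]mulr_natr divfK ?pnatr_eq0.
apply: ltr_sum; first by apply/hasP; exists ord0; rewrite // mem_index_enum.
move=> l _; rewrite normrM mxE; apply: le_lt_trans (hk l j).
rewrite -[leRHS]mul1r !mxE ler_wpM2r //.
exact: orthogonal_entry_le1 (orthogonal_exp k h) _ _.
Qed.

(** Discreteness is measured entrywise, which conjugation distorts; this bounds the distortion
    uniformly. *)
Lemma mulmx_entry_bound n (K L : 'M[R]_n) : exists2 C : R, 0 <= C &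
  forall (D : 'M[R]_n) d, (forall i j, `|D i j| <= d) ->
    forall i j, `|(K *m D *m L) i j| <= C * d.
Proof.
exists ((\sum_i \sum_j `|K i j|) * (\sum_i \sum_j `|L i j|)).
  by rewrite mulr_ge0 // sumr_ge0 // => i _; rewrite sumr_ge0.
move=> D d hD i j.
have rowle (M : 'M[R]_n) a : \sum_b `|M a b| <= \sum_a' \sum_b `|M a' b|.
  by rewrite [leRHS](bigD1 a) //= lerDl sumr_ge0 // => c _; rewrite sumr_ge0.
have d0 : 0 <= d by apply: le_trans (hD i j).
have hKD a b : `|(K *m D) a b| <= (\sum_i \sum_j `|K i j|) * d.
  rewrite mxE (le_trans (ler_norm_sum _ _ _)) //.
  apply: (@le_trans _ _ ((\sum_c `|K a c|) * d)); last by rewrite ler_wpM2r.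
  by rewrite mulr_suml ler_sum // => c _; rewrite normrM ler_wpM2l.
rewrite mxE (le_trans (ler_norm_sum _ _ _)) //.
rewrite mulrAC mulr_sumr.
apply: (@le_trans _ _ (\sum_k (\sum_i \sum_j `|K i j|) * d * `|L k j|)).
  by apply: ler_sum => k _; rewrite normrM ler_wpM2r.
rewrite ler_sum // => k _; rewrite ler_wpM2l //.
  by apply: le_trans (normr_ge0 _) (hKD i j).
by rewrite (bigD1 j) //= lerDl sumr_ge0.
Qed.

(** The Lorentz and Euclidean forms differ by 2 e5 e5^T, and the transpose of [A] fixes [e5] too. *)
Lemma form_stab_orthogonal (A : 'M[R]_5) :
  A^T *m Qform R *m A = Qform R -> A *m e5 R = e5 R -> A^T *m A = 1%:M.
Proof.
move=> hQ h5.
have Qe : Qform R *m e5 R = - e5 R.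
  by apply/colP; apply: ord5P; rewrite !mxE sum5E !mxE /=; ring.
have QE : Qform R + 2 *: (e5 R *m (e5 R)^T) = 1%:M.
  by apply/matrixP; apply: ord5P; apply: ord5P; rewrite !mxE big_ord1 !mxE /=; ring.
have A5 : A^T *m e5 R = e5 R.
  have := congr1 (mulmx^~ (e5 R)) hQ; rewrite /= -mulmxA h5 -mulmxA Qe mulmxN.
  exact: oppr_inj.
have A5T : (e5 R)^T *m A = (e5 R)^T by rewrite -[LHS]trmxK trmx_mul trmxK A5.
rewrite -[A^T]mulmx1 -{1}QE mulmxDr mulmxDl hQ.
by rewrite -scalemxAr -scalemxAl mulmxA A5 -mulmxA A5T.
Qed.

Lemma conj_exp n (K L g : 'M[R]_n.+1) m : K *m L = 1%:M -> L *m K = 1%:M ->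
  g ^+ m = K *m (L *m g *m K) ^+ m *m L.
Proof.
move=> KL LK; elim: m => [|m IH]; first by rewrite !expr0 mulmx1 KL.
rewrite exprS {}IH exprS -![_ * _]/(_ *m _).
by rewrite !mulmxA KL mul1mx.
Qed.

(* The stabilizer of a point is conjugate into the compact group O(4), so
   powers of its elements return near 1, and discreteness makes them torsion. *)
Lemma free_action (G : 'M[R]_5 -> Prop) (g : 'M[R]_5) (x : 'cV[R]_5) :
  is_subgroup_SO G -> discrete_SO G -> torsion_free_SO G ->
  inH4 x -> G g -> g *m x = x -> g = 1%:M.
Proof.
move=> [GSO [G1 [GM _]]] [eps [eps0 hd]] tf hx Gg gx.
have [v hv vx] := zeta_surj hx.
have [KQ [Kdet _]] := boost_mx_SO hv.
have := boost_mx_e5 v; rewrite vx; move: (boost_mx v) KQ Kdet => K KQ Kdet Kx.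
have Ku : K \in unitmx by rewrite unitmxE Kdet unitr1.
pose L := invmx K.
have KL : K *m L = 1%:M by rewrite mulmxV.
have LK : L *m K = 1%:M by rewrite mulVmx.
have [gQ _] := GSO _ Gg.
have LQ : L^T *m Qform R *m L = Qform R.
  by rewrite -{1}KQ !mulmxA -trmx_mul KL trmx1 mul1mx -mulmxA KL mulmx1.
pose h := L *m g *m K.
have h5 : h *m e5 R = e5 R by rewrite /h -!mulmxA Kx gx -Kx mulmxA LK mul1mx.
have hQ : h^T *m Qform R *m h = Qform R.
  by rewrite /h !trmx_mul -[in RHS]KQ -[in RHS]gQ -[in RHS]LQ !mulmxA.
have [C C0 hC] := mulmx_entry_bound K L.
(* [C + 1] is nonzero even if [C] is 0, and makes the final bound strict. *)
have d0 : 0 < eps / (C + 1) by rewrite divr_gt0 // ltr_wpDl.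
have [m [m0 hm]] := orthogonal_recurrent d0 (form_stab_orthogonal hQ h5).
apply: (tf _ Gg m m0); apply: hd.
  elim: (m) => [|k IH]; first by rewrite expr0.
  by rewrite exprS; apply: GM.
move=> i j.
have -> : (g ^+ m) i j - (1%:M : 'M[R]_5) i j = (K *m (h ^+ m - 1%:M) *m L) i j.
  by rewrite mulmxBr mulmxBl mulmx1 KL -conj_exp // !mxE.
apply: le_lt_trans (hC _ _ (fun i j => ltW (hm i j)) i j) _.
rewrite mulrA ltr_pdivrMr ?ltr_wpDl // mulrC ltr_pM2l //; lra.
Qed.

End FreeAction.

(** * Local contributions *)

Section Spin.
Variable R : realType.
Implicit Types (s k A B C : qmat R) (K L : 'M[R]_5).

Lemma spin_SU s : inSpin4 s -> inSU11 s.
Proof.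
case: s => p b c q [/= -> [-> [p1 q1]]]; apply/inSU11E => /=.
have n0 : qnorm2 (qzero R) = 0 by rewrite /qnorm2 /=; ring.
by rewrite n0 p1 q1 addr0 qmul0; split=> //; apply: quat_eq => /=; ring.
Qed.

Lemma inSU11_one : inSU11 (qmat_one R).
Proof. by apply: qmat_eq; apply: quat_eq => /=; ring. Qed.

Lemma su_fix0_spin s : inSU11 s -> mob s (qzero R) = qzero R -> inSpin4 s.
Proof.
move=> hs; have [n1 n2] := su_norms hs; have [e1 e2 _] := (inSU11E s).1 hs.
have nz : qnorm2 (m22 s) != 0 by rewrite e2 lt0r_neq0 // ltr_pwDl // qnorm2_ge0.
rewrite mobE /mnum /mden !qmul0 !q0add => /(congr1 (fun p => qmul p (m22 s))).
rewrite -qmulA qVmul // qmul1 q0mul => b0.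
have nb : qnorm2 (m12 s) = 0 by rewrite b0 /qnorm2 /=; ring.
split=> //; split; first by apply: qnorm2_eq0; rewrite n1.
by rewrite n2 e2 nb addr0.
Qed.

Lemma eta_spin s L : inSpin4 s -> eta_rel s L -> L *m e5 R = e5 R /\
  lin_part L = \matrix_(i < 4, j < 4)
    qcoord (qmul (qmul (m11 s) (qbasis R (widen_ord (leqnSn 4) j))) (qconj (m22 s)))
      (widen_ord (leqnSn 4) i).
Proof.
move=> hs; have sSU := spin_SU hs; case: s hs sSU => p b c q [/= -> [-> [p1 q1]]] sSU eL.
have numE y : mnum (QMat p (qzero R) (qzero R) q) y = qmul p y by rewrite /mnum /= qadd0.
have denE y : mden (QMat p (qzero R) (qzero R) q) y = q by rewrite /mden /= q0mul q0add.
have n0 : qnorm2 (qzero R) = 0 by rewrite /qnorm2 /=; ring.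
have L5 : L *m e5 R = e5 R.
  rewrite -[in LHS]zeta0 -(eL _ (inB4_0 R)) (zeta_mob sSU (inB4_0 R)).
  apply/colP => i; rewrite !mxE numE denE qmul0 q1 n0 q0mul.
  by move: i; apply: ord5P; rewrite /qcoord /=; field; rewrite ?oner_neq0.
split=> //; apply/matrixP => i j; rewrite !mxE.
set a := widen_ord _ i; set b' := widen_ord _ j.
have hw (l : 'I_4) : widen_ord (leqnSn 4) l != i5.
  by rewrite -val_eqE /= ltn_eqF.
have := eL _ (qhalf_inB4 R (hw j)); rewrite (zeta_mob sSU (qhalf_inB4 R (hw j))).
rewrite zeta_half ?hw // mulmxDr -!scalemxAr L5 -colE.
move=> /(congr1 (fun M : 'cV_5 => M a 0)).
rewrite !mxE numE denE (negPf (hw i)) qnorm2_half ?hw //.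
have -> : qcoord (qmul (qmul p (qhalf R b')) (qconj q)) a =
          qcoord (qmul (qmul p (qbasis R b')) (qconj q)) a / 2.
  by rewrite /qhalf; move: (qbasis R b') => z; rewrite /qcoord;
    case: (val a) => [|[|[|?]]] /=; field.
have -> : (1 - 1 / 4)^-1 = 4 / 3 :> R by field.
by rewrite -/b' => h; apply/esym; lra.
Qed.

Lemma Re_diag_conj A k s K : inSU11 k -> inSpin4 s -> eta_rel k K ->
  qmat_mul A k = qmat_mul k s ->
  qRe (m11 A) - qRe (m22 A) = (K *m e5 R) i5 0 * (qRe (m11 s) - qRe (m22 s)).
Proof.
move=> hk hs eK Ak.
have -> : A = qmat_mul (qmat_mul k s) (su_inv k).
  by rewrite -Ak -qmat_mulA su_mulVr // qmat_mul1.
have [n1 n2] := su_norms hk; have [e1 e2 _] := (inSU11E k).1 hk.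
rewrite -zeta0 -(eK _ (inB4_0 R)) (zeta_mob hk (inB4_0 R)) mxE eqxx.
have n0 : qnorm2 (qzero R) = 0 by rewrite /qnorm2 /=; ring.
rewrite n0 subr0 divr1 /mnum /mden !qmul0 !q0add.
case: s hs {Ak} => p b c q [+ [+ _]].
rewrite ![m12 (QMat _ _ _ _)]/= ![m21 (QMat _ _ _ _)]/= => -> ->.
(* Re(a p conj(a)) = |a|^2 Re p; the minus signs come from [Jq] inside [su_inv]. *)
have -> : qRe (m11 (qmat_mul (qmat_mul k (QMat p (qzero R) (qzero R) q)) (su_inv k))) =
  qnorm2 (m11 k) * qRe p - qnorm2 (m12 k) * qRe q by rewrite /qRe /qnorm2 /=; ring.
have -> : qRe (m22 (qmat_mul (qmat_mul k (QMat p (qzero R) (qzero R) q)) (su_inv k))) =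
  qnorm2 (m22 k) * qRe q - qnorm2 (m21 k) * qRe p by rewrite /qRe /qnorm2 /=; ring.
by rewrite n1 n2 e2; ring.
Qed.

Lemma tr_Psi1 (p : quat R) : \tr (Psi1 p) = ((2 * qRe p)%:C)%C.
Proof.
rewrite /mxtrace !big_ord_recl big_ord0 !mxE /= addr0 /qRe.
by apply/eqP; rewrite eq_complex /=; apply/andP; split; apply/eqP; ring.
Qed.

Lemma nu_formula_spin s L : inSpin4 s -> eta_rel s L ->
  nu_formula s L = ((2 * (qRe (m11 s) - qRe (m22 s)))^-1%:C)%C.
Proof.
move=> hs eL; have [_ linE] := eta_spin hs eL; have [_ [_ [p1 q1]]] := hs.
rewrite /nu_formula /Delta4p /Delta4m !tr_Psi1 linE det_sub_rotation //.
rewrite -rmorphB -fmorphV -rmorphM /=; congr (_%:C)%C.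
set d := qRe _ - qRe _.
have -> : `|4 * d ^+ 2| = 4 * d ^+ 2 by rewrite ger0_norm // mulr_ge0 ?sqr_ge0.
rewrite -mulrBr -/d.
(* At [d = 0] both sides are 0 by the convention that 0 has inverse 0. *)
have [->|d0] := eqVneq d 0; first by rewrite !mulr0 invr0 mul0r.
by field.
Qed.

(** The frame [k] may vary with the data: the value sees it only through [K *m e5 R = x]. *)
Lemma is_nu_conj (G : 'M[R]_5 -> Prop) (Gh : qmat R -> Prop) fh P (x : 'cV[R]_5) A :
  (exists g gh s Ls, nu_data G Gh fh P g gh s Ls) ->
  0 < x i5 0 ->
  (forall g gh s Ls, nu_data G Gh fh P g gh s Ls -> exists k K,
     [/\ inSU11 k, eta_rel k K, K *m e5 R = x & qmat_mul A k = qmat_mul k s]) ->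
  is_nu G Gh fh P ((x i5 0 / (2 * (qRe (m11 A) - qRe (m22 A))))%:C)%C.
Proof.
move=> ex x0 hdata; split=> // g gh s Ls data.
have [k [K [hk eK Kx Ak]]] := hdata _ _ _ _ data.
have [_ [_ [_ [_ [hs [_ es]]]]]] := data.
rewrite (nu_formula_spin hs es) (Re_diag_conj hk hs eK Ak) Kx.
congr (_%:C)%C; rewrite mulrCA [in RHS]invfM mulrA divff ?mul1r //.
by rewrite gt_eqF.
Qed.

Lemma su_mulI A B C : inSU11 A -> qmat_mul A B = qmat_mul A C -> B = C.
Proof.
move=> hA /(congr1 (qmat_mul (su_inv A))).
by rewrite !qmat_mulA su_mulVl // !qmat_1mul.
Qed.

Lemma su_group_inv (Gh : qmat R -> Prop) g : is_subgroup_SU Gh -> Gh g -> Gh (su_inv g).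
Proof.
move=> [hSU [_ [_ hV]]] Gg; have [h [Gh' e]] := hV _ Gg.
suff <- : h = su_inv g by [].
by rewrite -[LHS]qmat_1mul -(su_mulVl (hSU _ Gg)) -qmat_mulA e qmat_mul1.
Qed.

End Spin.

Lemma nu_data_exists (R : realType)
  (G : 'M[R]_5 -> Prop) (Gh : qmat R -> Prop) (fh : qmat R)
  (P : 'cV[R]_5 -> Prop) (x : 'cV[R]_5) (Phi : 'M[R]_5) (Phih : qmat R) :
  inH4 x -> same_set P (Gorbit G x) -> Phi *m x = x ->
  inSU11 Phih -> eta_rel Phih Phi -> same_symm Gh Phih fh ->
  exists g gh s Ls, nu_data G Gh fh P g gh s Ls.
Proof.
move=> hx Px Phix PhiSU ePhi hsymm.
have [v hv vx] := zeta_surj hx; have Kx := boost_mx_e5 v; rewrite vx in Kx.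
have hk := boost_qmat_SU hv; have eK := boost_eta hv.
have hKSO := boost_mx_SO hv; have [_ [Kdet _]] := hKSO.
move: (boost_mx v) (boost_qmat v) hKSO Kdet Kx hk eK => K k hKSO Kdet Kx hk eK.
have LK : invmx K *m K = 1%:M by rewrite mulVmx // unitmxE Kdet unitr1.
have eKV : eta_rel (su_inv k) (invmx K).
  move=> y hy; rewrite -[zeta (mob _ y)]mul1mx -LK -mulmxA -eK; last first.
    by apply: mob_inB4 => //; apply: inSU11_inv.
  by rewrite -mob_mul ?su_mulVr ?mob_one //; apply: inSU11_inv.
pose s := qmat_mul (su_inv k) (qmat_mul Phih k).
have hVk := inSU11_inv hk; have hPk := inSU11_mul PhiSU hk.
have sSU : inSU11 s by apply: inSU11_mul.
have es : eta_rel s (invmx K *m (Phi *m K)).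
  by apply: eta_mul => //; apply: eta_mul.
have ks : qmat_mul k s = qmat_mul Phih k.
  by rewrite /s qmat_mulA su_mulVr // qmat_1mul.
exists K, k, s, (invmx K *m (Phi *m K)); split=> //; split; first by rewrite Kx.
split=> //; split=> //; split; last first.
  by split=> // t; rewrite ks; apply: iff_sym; apply: hsymm.
apply: su_fix0_spin => //.
(* That [s] fixes the origin is checked on the hyperboloid, where only the origin lies below
   [e5]. *)
have h5 : zeta (mob s (qzero R)) = e5 R.
  by rewrite (es _ (inB4_0 R)) zeta0 -!mulmxA Kx Phix -Kx mulmxA LK mul1mx.
have := mob_inB4 sSU (inB4_0 R); move: (mob s _) h5 => w h5 hw.
have hn : 1 - qnorm2 w != 0 by rewrite gt_eqF // subr_gt0.
have z0 (i : 'I_5) : i != i5 -> qcoord w i = 0.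
  move=> hi; have := congr1 (fun M : 'cV_5 => M i 0) h5; rewrite !mxE (negPf hi).
  by move=> /eqP; rewrite !mulf_eq0 invr_eq0 (negPf hn) orbF pnatr_eq0 => /eqP.
by apply: quat_eq; [exact: (z0 o0)|exact: (z0 o1)|exact: (z0 o2)|exact: (z0 o3)].
Qed.

(* The cosets only give [Phih gh = d gh s] with [d] in [Gh]; freeness of [G]
   identifies [d] once [gh] is translated to the frame over [x]. *)
Lemma nu_data_conj (R : realType)
  (G : 'M[R]_5 -> Prop) (Gh : qmat R -> Prop) (fh : qmat R)
  (P : 'cV[R]_5 -> Prop) (x : 'cV[R]_5) (Phi : 'M[R]_5) (Phih : qmat R)
  (g : 'M[R]_5) (gh s : qmat R) (Ls : 'M[R]_5) :
  is_subgroup_SO G -> discrete_SO G -> torsion_free_SO G ->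
  is_subgroup_SU Gh -> lifts_iso Gh G -> normalizes_SU Gh fh ->
  inH4 x -> same_set P (Gorbit G x) -> Phi *m x = x ->
  inSU11 Phih -> eta_rel Phih Phi -> same_symm Gh Phih fh ->
  nu_data G Gh fh P g gh s Ls ->
  exists k K,
    [/\ inSU11 k, eta_rel k K, K *m e5 R = x & qmat_mul Phih k = qmat_mul k s].
Proof.
move=> hG hdisc htf hGh [GhG [GGh lift_inj]] [nfh _] hx Px Phix PhiSU ePhi hsymm.
move=> [hg [Pg [ghSU [egh [hs [hcos es]]]]]].
have [GSO [G1 [GM GV]]] := hG; have [GhSU [Gh1 [GhM _]]] := hGh.
have sSU := spin_SU hs; have [Ls5 _] := eta_spin hs es.
have cos_refl h : Gcoset Gh h h by exists (qmat_one R); rewrite qmat_1mul.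
have [d [Gd Pgd]] : Gcoset Gh (qmat_mul gh s) (qmat_mul Phih gh).
  by apply/hcos; apply/(hsymm _ ghSU).
have [d' [Gd' Pd']] : Gcoset Gh fh Phih.
  have := (hsymm _ (inSU11_one R) Phih).1; rewrite !qmat_mul1; apply.
  exact: cos_refl.
have [c [Gc gc]] : Gorbit G x (g *m e5 R).
  by apply/Px; apply/Pg; exists 1%:M; rewrite mul1mx.
have [ch [Gch ech]] := GGh _ Gc.
have [D [GD eD]] := GhG _ Gd.
have [c1 [Gc1 fc1]] := nfh _ Gch.
(* Since [Phih] is [d'] times [fh], it normalizes [Gh] as well, and [c2] is the conjugate of [ch] by
   [Phih]. *)
pose c2 := qmat_mul (qmat_mul d' c1) (su_inv d').
have Gc2 : Gh c2 := GhM _ _ (GhM _ _ Gd' Gc1) (su_group_inv hGh Gd').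
have Pc2 : qmat_mul Phih ch = qmat_mul c2 Phih.
  rewrite /c2 Pd' -[in RHS]qmat_mulA [qmat_mul (su_inv d') _]qmat_mulA.
  rewrite su_mulVl ?qmat_1mul; last exact: GhSU.
  by rewrite -!qmat_mulA fc1.
have [C2 [GC2 eC2]] := GhG _ Gc2.
have chSU := GhSU _ Gch; have dSU := GhSU _ Gd; have c2SU := GhSU _ Gc2.
have ePc : Phi *m c = C2 *m Phi.
  by apply: (@eta_unique _ (qmat_mul Phih ch)); [|rewrite Pc2]; apply: eta_mul.
have ePg : Phi *m g = D *m (g *m Ls).
  apply: (@eta_unique _ (qmat_mul Phih gh)); first exact: eta_mul.
  by rewrite Pgd; do ?apply: eta_mul => //; apply: inSU11_mul.
(* Both sides are the image of [g *m e5 R = c *m x] under [Phi]: one moves [Phi] past [c], the other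
   uses that [Ls] fixes [e5]. *)
have C2x : C2 *m x = D *m (c *m x).
  by rewrite -{1}Phix mulmxA -ePc -mulmxA -gc !mulmxA ePg -!mulmxA Ls5.
have [B [GB DcB]] := GV _ (GM _ _ GD Gc).
have BDc : B *m (D *m c) = 1%:M by exact: mulmx1C DcB.
have BC2 : B *m C2 = 1%:M.
  apply: (free_action hG hdisc htf hx (GM _ _ GB GC2)).
  by rewrite -mulmxA C2x !mulmxA -(mulmxA B) BDc mul1mx.
have C2E : C2 = D *m c by rewrite -[LHS]mul1mx -DcB -mulmxA BC2 mulmx1.
(* The equality [C2E] alone would leave a sign undetermined; both elements lie in [Gh], where the
   lift is unique. *)
have c2E : c2 = qmat_mul d ch.
  apply: (lift_inj _ _ C2) => //; first exact: GhM.
  by rewrite C2E; apply: eta_mul.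
have [cV [GcV ccV]] := GV _ Gc.
have cVc : cV *m c = 1%:M by exact: mulmx1C ccV.
have chV := inSU11_inv chSU.
have echV : eta_rel (su_inv ch) cV.
  move=> y hy; have hm : inB4 (mob (su_inv ch) y) by apply: mob_inB4.
  by rewrite -[LHS]mul1mx -cVc -mulmxA -ech // -mob_mul // su_mulVr // mob_one.
exists (qmat_mul (su_inv ch) gh), (cV *m g); split.
- exact: inSU11_mul.
- exact: eta_mul.
- by rewrite -mulmxA gc mulmxA cVc mul1mx.
have : gh = qmat_mul ch (qmat_mul (su_inv ch) gh).
  by rewrite qmat_mulA su_mulVr // qmat_1mul.
move: (qmat_mul (su_inv ch) gh) => k ghE.
(* With [gh = ch k], the product [Phih gh] is both [c2 Phih k = d ch Phih k] and [d ch k s]. *)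
apply: (@su_mulI _ (qmat_mul d ch)); first exact: inSU11_mul.
by rewrite qmat_mulA -c2E -Pc2 -qmat_mulA -ghE Pgd ghE c2E !qmat_mulA.
Qed.

Theorem theorem7p5 (R : realType)
  (G : 'M[R]_5 -> Prop) (Gh : qmat R -> Prop)
  (f : 'M[R]_5) (fh : qmat R)
  (P : 'cV[R]_5 -> Prop) (x : 'cV[R]_5)
  (Phi : 'M[R]_5) (Phih : qmat R) :
  (* M = G \ H^4 closed hyperbolic 4-manifold *)
  is_subgroup_SO G -> discrete_SO G -> torsion_free_SO G -> cocompact_SO G ->
  (* spin structure Ghat \ SU(1,1;H) *)
  is_subgroup_SU Gh -> lifts_iso Gh G ->
  (* phi = f_star orientation-preserving isometry *)
  inSOp41 f -> normalizes_SO G f ->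
  (* phihat = fh_star symmetry lifting phi *)
  inSU11 fh -> normalizes_SU Gh fh -> is_lift_symm G fh f ->
  (* P = G x isolated fixed point of phi *)
  inH4 x -> same_set P (Gorbit G x) -> isolated_fixed_point G f x ->
  (* Phi : phi = Phi_star, Phi x = x *)
  inSOp41 Phi -> same_isom G Phi f -> Phi *m x = x ->
  (* Phihat : lift of Phi with phihat = Phihat_star *)
  inSU11 Phih -> eta_rel Phih Phi -> same_symm Gh Phih fh ->
  is_nu G Gh fh P
    ((x i5 0 / (2 * (qRe (m11 Phih) - qRe (m22 Phih))))%:C)%C.
Proof.
move=> hG hdisc htf _ hGh hlift _ _ _ nfh _ hx Px _ _ _ Phix PhiSU ePhi hsymm.
apply: is_nu_conj; [exact: (nu_data_exists hx Px Phix PhiSU ePhi hsymm)|by case: hx|].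
move=> g gh s Ls.
exact: (nu_data_conj hG hdisc htf hGh hlift nfh hx Px Phix PhiSU ePhi hsymm).
Qed.
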